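(* Let $R$ be an integral domain, let $n>1$ be a natural number, let $\varphi_0,\varphi_1,\ldots,\varphi_n\in R$, and let $\omega$ be a Dumas valuation on $R$ (of the first or of the second kind) such that $\omega(\varphi_n)=0$, $\omega(\varphi_0)\in\mathbb N$ and $\gcd(n,\omega(\varphi_0))=1$. Assume that one of the following two cases holds: (I) $\omega$ is a Dumas valuation of the first kind, $n\omega(\varphi_j)\le (n-j)\omega(\varphi_0)$ for $j=1,\ldots,n-1$, and $n\le 7$; (II) $\omega$ is a Dumas valuation of the second kind, $n\omega(\varphi_j)\ge (n-j)\omega(\varphi_0)$ for $j=1,\ldots,n-1$, and $n\le 6$. Then the polynomial $f=\varphi_nX^n+\cdots+\varphi_1X+\varphi_0\in R[X]$ cannot be written as a product $f=gh$ with $g,h\in R[X]$ of degrees at least one.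
   Context: Here $\mathbb N=\{1,2,\ldots\}$ and $\mathbb N_0=\mathbb N\cup\{0\}$. All rings are commutative with identity. Let $R$ be an integral domain. A Dumas valuation of the first kind on $R$ is a map $\omega:R\to\mathbb N_0\cup\{-\infty\}$ such that for all $x,y\in R$: $\omega(x)\ge 0$ if $x\ne 0$; $\omega(xy)=\omega(x)+\omega(y)$; $\omega(x)=-\infty$ if and only if $x=0$; $\omega(x+y)\le\max\{\omega(x),\omega(y)\}$, with equality if $\omega(x)\ne\omega(y)$. A Dumas valuation of the second kind on $R$ is a map $\omega:R\to\mathbb N_0\cup\{+\infty\}$ such that for all $x,y\in R$: $\omega(x)\ge 0$ if $x\ne 0$; $\omega(xy)=\omega(x)+\omega(y)$; $\omega(x)=+\infty$ if and only if $x=0$; $\omega(x+y)\ge\min\{\omega(x),\omega(y)\}$, with equality if $\omega(x)\neq\omega(y)$. The usual conventions for $\pm\infty$ apply: $(\pm\infty)+k=\pm\infty$, and $-\infty<k<+\infty$ for $k\in\mathbb N_0$. *)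

(* Defs.v *)
From HB Require Import structures.
From mathcomp Require Import all_boot all_order all_algebra.
From mathcomp Require Export constructive_ereal.

Set Implicit Arguments.
Unset Strict Implicit.
Unset Printing Implicit Defensive.

Import Order.TTheory GRing.Theory Num.Theory.
Local Open Scope ring_scope.
Local Open Scope ereal_scope.

(* The codomains N_0 U {-oo} and N_0 U {+oo} are carved out of [\bar int], whose
   order and addition restrict to the usual conventions on them; the sum
   (-oo) + (+oo) never occurs. *)

Record dumas_valuation1 (R : idomainType) (w : R -> \bar int) : Prop := {
  dumas1_codom : forall x, w x = -oo \/ exists k : nat, w x = (k%:Z)%:E;
  dumas1_ge0 : forall x, x != 0%R -> 0 <= w x;
  dumas1M : forall x y, w (x * y)%R = w x + w y;
  dumas1_0 : forall x, w x = -oo <-> x = 0%R;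
  dumas1D : forall x y, w (x + y)%R <= maxe (w x) (w y);
  dumas1D_neq : forall x y, w x <> w y -> w (x + y)%R = maxe (w x) (w y)
}.

Record dumas_valuation2 (R : idomainType) (w : R -> \bar int) : Prop := {
  dumas2_codom : forall x, w x = +oo \/ exists k : nat, w x = (k%:Z)%:E;
  dumas2_ge0 : forall x, x != 0%R -> 0 <= w x;
  dumas2M : forall x y, w (x * y)%R = w x + w y;
  dumas2_0 : forall x, w x = +oo <-> x = 0%R;
  dumas2D : forall x y, mine (w x) (w y) <= w (x + y)%R;
  dumas2D_neq : forall x y, w x <> w y -> w (x + y)%R = mine (w x) (w y)
}.

(* Main.v *)
Require Import Defs.
From HB Require Import structures.
From mathcomp Require Import all_boot all_order all_algebra.
From mathcomp Require Import constructive_ereal.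
From mathcomp Require Import zify.

(** A Dumas valuation of the second kind is, away from 0, an integer-valued
    non-archimedean valuation [v], and so is the opposite of one of the first
    kind.  After this change of sign both cases of the theorem say the same
    thing: the points (j, v (phi j)) lie on or above the segment joining
    (0, v (phi 0)) to (n, v (phi n)), and this segment contains no lattice point
    but its endpoints.  This is the hypothesis of Dumas's irreducibility
    criterion, the case of a Newton polygon with a single primitive edge.

    The criterion is proved with one linear weight in place of Newton polygons.
    Give the monomial c X^j the weight n v(c) + b j, where the slope
    b = v (phi 0) - v (phi n) makes the end monomials of f have equal weight.
    The hypothesis says that this common weight is the minimum over f.  If
    f = g h, Gauss's lemma [coef_mul_weight] shows that minimal weights add up,
    so both end monomials of g have minimal weight in g: with d the degree of g,
    n v(g_0) = n v(g_d) + b d.  Hence n divides b d; as n is prime to b it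
    divides d, and 0 < d < n is impossible. *)

Set Implicit Arguments.
Unset Strict Implicit.
Unset Printing Implicit Defensive.

Import Order.TTheory GRing.Theory Num.Theory.
Local Open Scope ring_scope.

(** The value at 0 is left unspecified, standing for an infinite one: every axiom
    is restricted to nonzero elements, which keeps all arithmetic in [int]. *)
Record int_valuation (R : idomainType) (v : R -> int) : Prop := {
  int_valM : forall x y, x != 0 -> y != 0 -> v (x * y) = v x + v y;
  int_valD : forall x y, x != 0 -> y != 0 -> x + y != 0 ->
    Num.min (v x) (v y) <= v (x + y)
}.

(** These sets are additive subgroups, which takes care of sums that cancel. *)
Definition val_ge (R : idomainType) (v : R -> int) (c : int) (x : R) : bool :=
  (x == 0) || (c <= v x).

Lemma int_valN (R : idomainType) (v : R -> int) (x : R) :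
  int_valuation v -> v (- x) = v x.
Proof.
move=> vP; have [->|x0] := eqVneq x 0; first by rewrite oppr0.
have v1 : v 1 = 0.
  by apply: (addrI (v 1)); rewrite -(int_valM vP) ?oner_neq0 // mulr1 addr0.
have N10 : (- 1 : R) != 0 by rewrite oppr_eq0 oner_neq0.
have vN1 : v (- 1) = 0.
  have: v (- 1 * - 1) = 0 by rewrite mulrNN mulr1.
  by rewrite (int_valM vP) //; lia.
by rewrite -(mulN1r x) (int_valM vP) // vN1 add0r.
Qed.

Lemma val_geD (R : idomainType) (v : R -> int) (c : int) (x y : R) :
  int_valuation v -> val_ge v c x -> val_ge v c y -> val_ge v c (x + y).
Proof.
move=> vP; rewrite /val_ge.
have [->|x0] := eqVneq x 0; first by rewrite add0r.
have [->|y0] := eqVneq y 0; first by rewrite addr0 (negbTE x0).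
have [//|xy0] := eqVneq (x + y) 0.
by move=> /= cx cy; apply: le_trans (int_valD vP x0 y0 xy0); rewrite le_min cx.
Qed.

Lemma val_geN (R : idomainType) (v : R -> int) (c : int) (x : R) :
  int_valuation v -> val_ge v c (- x) = val_ge v c x.
Proof. by move=> vP; rewrite /val_ge oppr_eq0 (int_valN _ vP). Qed.

Lemma int_valuation_scale (R : idomainType) (v : R -> int) (n : nat) :
  int_valuation v -> int_valuation (fun x => n%:Z * v x).
Proof.
move=> vP; split=> [x y x0 y0|x y x0 y0 xy0].
  by rewrite (int_valM vP) // mulrDr.
by rewrite -minr_pMr // ler_wpM2l // (int_valD vP).
Qed.

(** The tie-breaking towards small indices is what isolates a single dominant
    term in a coefficient of a product. *)
Lemma first_minimizer (F : nat -> int) (P : pred nat) (N i : nat) :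
  (i < N)%N -> P i ->
  exists2 k, P k &
    forall j, (j < N)%N -> P j -> F k <= F j /\ ((j < k)%N -> F k < F j).
Proof.
move=> ltiN Pi.
pose minimal := [pred k | P k && [forall j : 'I_N, P j ==> (F k <= F j)]].
have exmin : exists k, minimal k.
  case: (@arg_minP _ _ _ (Ordinal ltiN) (fun j => P j) (fun j => F j) Pi).
  move=> k Pk kmin.
  by exists k; rewrite /= Pk; apply/forallP => j; apply/implyP => /kmin.
case: (ex_minnP exmin) => k /andP[Pk /forallP kmin] kfirst.
exists k => // j ltj Pj.
have leF j' : (j' < N)%N -> P j' -> F k <= F j'.
  by move=> ltj' Pj'; apply: (implyP (kmin (Ordinal ltj'))).
split=> [|ltjk]; first exact: leF.
rewrite ltNge; apply: contraL ltjk => leFjk; rewrite -leqNgt; apply: kfirst.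
rewrite /= Pj; apply/forallP => j'; apply/implyP => Pj'.
exact: le_trans leFjk (leF _ (ltn_ord j') Pj').
Qed.

(** Gauss's lemma for the weight v(c) + b j of a monomial c X^j.  Let i0 and j0 be
    the first indices of minimal weight in g and h.  In the coefficient of
    X^(i0 + j0) of g h, any other term g_i h_j has i < i0 or j < j0, hence a
    strictly larger value than g_i0 h_j0, and cannot cancel it. *)
Lemma coef_mul_weight (R : idomainType) (v : R -> int) (b : int)
    (g h : {poly R}) :
  int_valuation v -> g != 0 -> h != 0 ->
  exists2 k, (g * h)`_k != 0 &
    forall i j, g`_i != 0 -> h`_j != 0 ->
      v (g * h)`_k + b * k%:Z <= (v g`_i + b * i%:Z) + (v h`_j + b * j%:Z).
Proof.
move=> vP g0 h0.
have first_min (p : {poly R}) : p != 0 -> exists2 k, p`_k != 0 &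
    forall j, p`_j != 0 -> v p`_k + b * k%:Z <= v p`_j + b * j%:Z /\
      ((j < k)%N -> v p`_k + b * k%:Z < v p`_j + b * j%:Z).
  move=> p0.
  have lt_deg : ((size p).-1 < size p)%N by rewrite prednK // size_poly_gt0.
  have lead0 : p`_(size p).-1 != 0 by rewrite -lead_coefE lead_coef_eq0.
  have [k pk kmin] := @first_minimizer (fun j => v p`_j + b * j%:Z)
    (fun j => p`_j != 0) _ _ lt_deg lead0.
  exists k => // j pj; apply: kmin => //.
  by rewrite ltnNge; apply: contra pj => le; rewrite nth_default.
have [i0 gi0 gmin] := first_min g g0; have [j0 hj0 hmin] := first_min h h0.
set c : int := v g`_i0 + v h`_j0.
have not_ge : ~~ val_ge v (c + 1) (g * h)`_(i0 + j0).
  have lti0 : (i0 < (i0 + j0).+1)%N by rewrite ltnS leq_addr.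
  rewrite coefM (bigD1 (Ordinal lti0)) //= addKn.
  set rest := \sum_(i | _) _.
  (* Values in [int] are discrete: larger than c means at least c + 1. *)
  have rest_ge : val_ge v (c + 1) rest.
    apply: (big_ind (fun x => val_ge v (c + 1) x)) => [|x y|[i /= ltik] nei].
    - by rewrite /val_ge eqxx.
    - exact: val_geD.
    rewrite -val_eqE /= in nei.
    set j := (i0 + j0 - i)%N; have ijE : (i + j = i0 + j0)%N by rewrite /j; lia.
    have [gi|gi] := eqVneq g`_i 0; first by rewrite gi mul0r /val_ge eqxx.
    have [hj|hj] := eqVneq h`_j 0; first by rewrite hj mulr0 /val_ge eqxx.
    have bE : b * i%:Z + b * j%:Z = b * i0%:Z + b * j0%:Z.
      by rewrite -!mulrDr -!PoszD ijE.
    rewrite /val_ge (int_valM vP) // /c; apply/orP; right.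
    have [lei lti] := gmin i gi; have [lej ltj] := hmin j hj.
    rewrite lezD1 -(ltrD2r (b * i%:Z + b * j%:Z)) {1}bE !(addrACA _ _ (b * _)).
    have /orP[lt|lt] : (i < i0)%N || (j < j0)%N by move: nei ijE; lia.
      exact: ltr_leD (lti lt) lej.
    exact: ler_ltD lei (ltj lt).
  (* Otherwise the dominant term would be a difference of elements of value
     above c. *)
  apply/negP => tot_ge.
  have : val_ge v (c + 1) (g`_i0 * h`_j0).
    rewrite -[_ * _](addrK rest); apply: val_geD => //.
    by rewrite val_geN.
  rewrite /val_ge mulf_eq0 (negbTE gi0) (negbTE hj0) (int_valM vP) //=.
  by rewrite -/c lezD1 ltxx.
move: not_ge; rewrite /val_ge negb_or -ltNge => /andP[gh0 ltc].
exists (i0 + j0)%N => // i j gi hj.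
have [lei _] := gmin i gi; have [lej _] := hmin j hj.
apply: le_trans (lerD lei lej).
by rewrite PoszD mulrDr addrACA lerD2r -ltzD1.
Qed.

(** The valuation is multiplied by n so that the slope of the segment from
    (0, v p_0) to (n, v p_n) becomes the integer b.  Each end monomial of p is the
    product of the corresponding end monomials of g and h; since minimal weights
    add up, neither factor can exceed its own minimum there. *)
Lemma dumas_criterion (R : idomainType) (v : R -> int) (n : nat)
    (p g h : {poly R}) :
  int_valuation v -> size p = n.+1 -> p`_0 != 0 ->
  (forall j, (j <= n)%N -> p`_j != 0 ->
     (n - j)%N%:Z * v p`_0 + j%:Z * v p`_n <= n%:Z * v p`_j) ->
  coprimez n (v p`_0 - v p`_n) ->
  p = g * h -> (size g <= 1)%N || (size h <= 1)%N.
Proof.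
move=> vP szp p00 above cop pE.
rewrite leqNgt [(size h <= 1)%N]leqNgt -negb_and.
apply/negP => /andP[gt1g gt1h].
have g0 : g != 0 by rewrite -size_poly_gt0 ltnW.
have h0 : h != 0 by rewrite -size_poly_gt0 ltnW.
pose d := (size g).-1; pose e := (size h).-1; pose b := v p`_0 - v p`_n.
have nE : n = (d + e)%N.
  by have := size_mul g0 h0; rewrite -pE szp /d /e; lia.
have p0E : p`_0 = g`_0 * h`_0 by rewrite pE -!horner_coef0 hornerM.
have gd0 : g`_d != 0 by rewrite -lead_coefE lead_coef_eq0.
have he0 : h`_e != 0 by rewrite -lead_coefE lead_coef_eq0.
have pnE : p`_n = g`_d * h`_e.
  by have := lead_coefM g h; rewrite -pE !lead_coefE szp.
have [g00 h00] : g`_0 != 0 /\ h`_0 != 0.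
  by apply/andP; rewrite -negb_or -mulf_eq0 -p0E.
have v0 : v p`_0 = v g`_0 + v h`_0 by rewrite p0E (int_valM vP).
have vn : v p`_n = v g`_d + v h`_e by rewrite pnE (int_valM vP).
have [k pk kmin] := coef_mul_weight b (int_valuation_scale n vP) g0 h0.
rewrite -pE in pk kmin.
have lekn : (k <= n)%N.
  by rewrite -ltnS -szp ltnNge; apply: contra pk => le; rewrite nth_default.
have p_ge : n%:Z * v p`_0 <= n%:Z * v p`_k + b * k%:Z.
  have := above k lekn pk; rewrite -subzn // /b; nia.
(* Comparing k with the products g_0 h_e and g_d h_0 gives one inequality each;
   the weights of p_0 and p_n, both equal to n v(p_0), turn them into an
   equality. *)
have tie : n%:Z * (v g`_0 - v g`_d) = b * d%:Z.
  have nbE : n%:Z * b = b * d%:Z + b * e%:Z by rewrite nE PoszD mulrC mulrDr.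
  have nb : n%:Z * b = n%:Z * v p`_0 - n%:Z * v p`_n by rewrite mulrBr.
  have n0 : n%:Z * v p`_0 = n%:Z * v g`_0 + n%:Z * v h`_0 by rewrite v0 mulrDr.
  have nn : n%:Z * v p`_n = n%:Z * v g`_d + n%:Z * v h`_e by rewrite vn mulrDr.
  rewrite mulrBr.
  have := kmin 0%N e g00 he0; have := kmin d 0%N gd0 h00.
  rewrite !mulr0; lia.
have : (n %| b * d%:Z)%Z.
  by apply/dvdzP; exists (v g`_0 - v g`_d); rewrite -tie mulrC.
rewrite Gauss_dvdzr // dvdzE /= => /dvdn_leq.
by rewrite /d /e in nE *; lia.
Qed.

(** A valuation of the first kind behaves like a degree, so its opposite satisfies
    the ultrametric inequality with a minimum. *)
Lemma dumas1_int_valuation (R : idomainType) (w : R -> \bar int) :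
  dumas_valuation1 w ->
  int_valuation (fun x => - fine (w x)) /\
  (forall x, x != 0 -> w x = (fine (w x))%:E).
Proof.
move=> wP.
have wE x : x != 0 -> w x = (fine (w x))%:E.
  move=> /eqP x0; case: (dumas1_codom wP x) => [/(dumas1_0 wP)//|[k ->] //].
split=> //; split=> [x y x0 y0|x y x0 y0 xy0].
  by rewrite (dumas1M wP) (wE x x0) (wE y y0) -opprD.
have := dumas1D wP x y.
by rewrite (wE _ x0) (wE _ y0) (wE _ xy0) -EFin_max lee_fin /=; lia.
Qed.

Lemma dumas2_int_valuation (R : idomainType) (w : R -> \bar int) :
  dumas_valuation2 w ->
  int_valuation (fun x => fine (w x)) /\
  (forall x, x != 0 -> w x = (fine (w x))%:E).
Proof.
move=> wP.
have wE x : x != 0 -> w x = (fine (w x))%:E.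
  move=> /eqP x0; case: (dumas2_codom wP x) => [/(dumas2_0 wP)//|[k ->] //].
split=> //; split=> [x y x0 y0|x y x0 y0 xy0].
  by rewrite (dumas2M wP) (wE x x0) (wE y y0).
have := dumas2D wP x y.
by rewrite (wE _ x0) (wE _ y0) (wE _ xy0) -EFin_min lee_fin.
Qed.

Theorem theorem0p1 (R : idomainType) (n : nat) (phi : nat -> R)
    (w : R -> \bar int) (m : nat)
    (hn : (1 < n)%N)
    (hw : dumas_valuation1 w \/ dumas_valuation2 w)
    (hwn : w (phi n) = 0%E)
    (hw0 : w (phi 0%N) = (m%:Z)%:E)
    (hm : (0 < m)%N)
    (hgcd : gcdn n m = 1%N)
    (hcase :
      [/\ dumas_valuation1 w,
          (forall j : nat, (1 <= j <= n.-1)%N ->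
             (w (phi j) *+ n <= w (phi 0%N) *+ (n - j))%E)
        & (n <= 7)%N]
      \/
      [/\ dumas_valuation2 w,
          (forall j : nat, (1 <= j <= n.-1)%N ->
             (w (phi 0%N) *+ (n - j) <= w (phi j) *+ n)%E)
        & (n <= 6)%N]) :
  ~ exists g h : {poly R},
      [/\ \sum_(i < n.+1) phi i *: 'X^i = g * h,
          (1 < size g)%N
        & (1 < size h)%N].
Proof.
have neq0 x (k : int) : w x = k%:E -> x != 0.
  move=> wx; apply/eqP => x0; case: hw => wP.
    by have /(dumas1_0 wP) := x0; rewrite wx.
  by have /(dumas2_0 wP) := x0; rewrite wx.
have [phi0 phin] := (neq0 _ _ hw0, neq0 _ _ hwn).
(* From here on the two kinds are treated alike; s is the sign of the change
   from w to v. *)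
have [s [v [vP vE above]]] : exists s v, [/\ int_valuation v,
    (s = 1 \/ s = -1) /\ (v (phi 0) = s * m%:Z /\ v (phi n) = 0) &
    forall j, (0 < j < n)%N -> phi j != 0 ->
      (n - j)%N%:Z * v (phi 0) <= n%:Z * v (phi j)].
  have le_ltn j : (0 < j < n)%N -> (1 <= j <= n.-1)%N by lia.
  case: hcase => [[wP above _]|[wP above _]].
    have [vP wE] := dumas1_int_valuation wP.
    exists (-1), (fun x => - fine (w x)); split=> //.
      by rewrite hw0 hwn oppr0 mulN1r; split; [right|].
    move=> j /le_ltn/above + phij; rewrite (wE _ phij) hw0.
    rewrite -(EFin_natmul _ n) -(EFin_natmul _ (n - j)) lee_fin.
    by rewrite -(mulr_natl _ n) -(mulr_natl _ (n - j)) !natz /= ?mulrN ?lerN2.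
  have [vP wE] := dumas2_int_valuation wP.
  exists 1, (fun x => fine (w x)); split=> //.
    by rewrite hw0 hwn mul1r; split; [left|].
  move=> j /le_ltn/above + phij; rewrite (wE _ phij) hw0.
  rewrite -(EFin_natmul _ n) -(EFin_natmul _ (n - j)) lee_fin.
  by rewrite -(mulr_natl _ n) -(mulr_natl _ (n - j)) !natz /= ?mulrN ?lerN2.
have [sE [v0 vn]] := vE.
case=> g [h [pE gt1g gt1h]]; rewrite -poly_def in pE.
have coefE j : (j <= n)%N -> (\poly_(i < n.+1) phi i)`_j = phi j.
  by move=> lejn; rewrite coef_poly ltnS lejn.
suff: (size g <= 1)%N || (size h <= 1)%N by rewrite leqNgt gt1g leqNgt gt1h.
apply: (dumas_criterion vP (size_poly_eq phin) _ _ _ pE); rewrite !coefE //.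
  move=> j lejn; rewrite coefE // => phij; rewrite vn mulr0 addr0.
  have [->|j0] := posnP j; first by rewrite subn0.
  have [->|ltjn] := eqVneq j n; first by rewrite subnn vn mul0r mulr0.
  by apply: above => //; rewrite j0 ltn_neqAle ltjn.
rewrite vn subr0 v0 /coprimez /gcdz.
by case: sE => ->; rewrite ?mulN1r ?mul1r ?abszN /= hgcd.
Qed.
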